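(* Let $\kappa > \omega$ be a regular cardinal. If $\mathfrak{b}(\kappa) = \kappa^{+}$, then $\mathfrak{a}(\kappa) = \kappa^{+}$.
   Context: For $f, g \in \kappa^\kappa$, $f \leq^* g$ means $|\{\alpha<\kappa : g(\alpha) < f(\alpha)\}| < \kappa$. A family $F \subseteq \kappa^\kappa$ is unbounded if there is no $g \in \kappa^\kappa$ with $f \leq^* g$ for all $f \in F$; $\mathfrak{b}(\kappa)$ is the least size of an unbounded family. Sets $A, B \in [\kappa]^\kappa$ are almost disjoint if $|A \cap B| < \kappa$; a family $\mathscr{A} \subseteq [\kappa]^\kappa$ is maximal almost disjoint (m.a.d.) if its members are pairwise almost disjoint, $|\mathscr{A}| \geq \kappa$, and no $B \in [\kappa]^\kappa$ is almost disjoint from every member of $\mathscr{A}$ (i.e. $\mathscr{A}$ cannot be extended to a larger almost disjoint family in $[\kappa]^\kappa$). $\mathfrak{a}(\kappa)$ is the least size of a m.a.d. family in $[\kappa]^\kappa$. *)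

(* Defs.v *)
(* naive set theory over Rocq types.
   Sets are predicates  S : A -> Prop ; cardinals are compared via injections.
   The cardinal kappa is represented by a type K with a strict well-order lt
   (an initial ordinal: every proper initial segment has size < kappa). *)
From Stdlib Require Import Relations Wellfounded.

Definition full {A : Type} : A -> Prop := fun _ => True.

Definition card_le {A B : Type} (S : A -> Prop) (T : B -> Prop) : Prop :=
  exists f : A -> B, (forall x, S x -> T (f x)) /\
    (forall x y, S x -> S y -> f x = f y -> x = y).

Definition well_order_on {A : Type} (S : A -> Prop) (R : A -> A -> Prop) : Prop :=
  well_founded R /\
  (forall x, S x -> ~ R x x) /\
  (forall x y z, S x -> S y -> S z -> R x y -> R y z -> R x z) /\
  (forall x y, S x -> S y -> R x y \/ x = y \/ R y x).

Section Kappa.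
Context {K : Type} (lt : K -> K -> Prop).

Definition small (X : K -> Prop) : Prop := ~ card_le (@full K) X.

Definition is_cardinal : Prop :=
  well_order_on (@full K) lt /\ forall x, small (fun y => lt y x).

Definition is_regular : Prop :=
  forall X : K -> Prop, small X -> exists b, forall y, X y -> lt y b.

Definition uncountable : Prop := ~ card_le (@full K) (@full nat).

(* a set S has cardinality exactly kappa^+ : |S| > kappa and S can be
   well-ordered with every proper initial segment of size <= kappa *)
Definition size_succ {A : Type} (S : A -> Prop) : Prop :=
  ~ card_le S (@full K) /\
  exists R : A -> A -> Prop, well_order_on S R /\
    forall x, S x -> card_le (fun y => S y /\ R y x) (@full K).

Definition leq_star (f g : K -> K) : Prop := small (fun a => lt (g a) (f a)).

Definition unbounded (F : (K -> K) -> Prop) : Prop :=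
  ~ exists g : K -> K, forall f, F f -> leq_star f g.

Definition b_eq_succ : Prop :=
  (exists F, unbounded F /\ size_succ F) /\
  (forall F, unbounded F -> ~ card_le F (@full K)).

Definition big (X : K -> Prop) : Prop := card_le (@full K) X.

Definition almost_disjoint (X Y : K -> Prop) : Prop := small (fun a => X a /\ Y a).

Definition mad (A : (K -> Prop) -> Prop) : Prop :=
  (forall X, A X -> big X) /\
  (forall X Y, A X -> A Y -> X <> Y -> almost_disjoint X Y) /\
  card_le (@full K) A /\
  ~ exists B, big B /\ forall X, A X -> almost_disjoint X B.

Definition a_eq_succ : Prop :=
  (exists A, mad A /\ size_succ A) /\
  (forall A, mad A -> ~ card_le A (@full K)).

End Kappa.

(* Main.v *)
(** Call [c] closed under [p : K -> K] if [p] maps the segment below [c] into itself; the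
    sets of closed points generate the club filter.  Since [K] is uncountable, an unbounded
    family can be replaced by a family [phi f] unbounded modulo clubs: no [g] satisfies
    [phi f <= g] on a club for every [f] (Cummings and Shelah).

    Start from disjoint big sets [D j] and define by recursion [A f], the union over [c] of
    the intervals [[c, phi f c)] from which one removes [D j] for [j < c] and the previous
    sets [A y] whose index in a fixed enumeration by [K] of the predecessors of [f] is [< c].
    If [B] is almost disjoint from everything, let [g c] be a point of [B] above [c], and
    take [f] with [phi f > g] on a stationary set.  For a club of [c], none of the removed
    sets meets [B] above [c], so [g c] lies in [A f] for unboundedly many [c]. *)
Require Import Defs.
From Stdlib Require Import Classical ClassicalEpsilon IndefiniteDescription.
From Stdlib Require Import FunctionalExtensionality.
From Stdlib Require Import Relation_Operators Disjoint_Union Inverse_Image.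

(** * Comparison of cardinals and well-founded recursion *)

Lemma card_le_trans {A B C : Type} (S : A -> Prop) (T : B -> Prop) (U : C -> Prop) :
  card_le S T -> card_le T U -> card_le S U.
Proof.
  intros [f [Hf If]] [g [Hg Ig]]. exists (fun x => g (f x)). split; auto.
Qed.

Lemma card_le_incl {A : Type} (S T : A -> Prop) : (forall x, S x -> T x) -> card_le S T.
Proof. intros H. exists (fun x => x). auto. Qed.

Lemma card_le_of_image {C A B : Type} (T : A -> Prop) (p : A -> B) (X : B -> Prop) :
  (forall y, X y -> exists x, T x /\ p x = y) ->
  card_le (@full C) X -> card_le (@full C) T.
Proof.
  intros H [f [Hf If]].
  destruct (functional_choice (fun k x => T x /\ p x = f k)) as [q Hq].
  { intros k. apply H, Hf. exact I. }
  exists q. split.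
  - intros k _. apply Hq.
  - intros j k _ _ E. apply If; try exact I.
    destruct (Hq j) as [_ <-], (Hq k) as [_ <-]. now rewrite E.
Qed.

Lemma well_founded_fixpoint {I T : Type} (R : I -> I -> Prop) (wfR : well_founded R)
  (G : forall i : I, (forall j, R j i -> T) -> T) :
  exists A : I -> T, forall i, A i = G i (fun j _ => A j).
Proof.
  exists (Fix wfR (fun _ => T) G). intros i. apply (Fix_eq wfR (fun _ => T) G).
  intros x f g H. f_equal. extensionality j. extensionality r. apply H.
Qed.

(** * Order, suprema and boundedness in a regular uncountable cardinal *)

Section RegularCardinal.
Context {K : Type} (lt : K -> K -> Prop).
Context (Hcard : is_cardinal lt) (Hreg : is_regular lt) (Hunc : uncountable (K := K)).

Let wf : well_founded lt := proj1 (proj1 Hcard).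

Lemma lt_irrefl x : ~ lt x x.
Proof. apply (proj1 Hcard). exact I. Qed.

Lemma lt_trans x y z : lt x y -> lt y z -> lt x z.
Proof. apply (proj1 Hcard); exact I. Qed.

Lemma lt_total x y : lt x y \/ x = y \/ lt y x.
Proof. apply (proj1 Hcard); exact I. Qed.

Lemma le_lt_trans x y z : ~ lt y x -> lt y z -> lt x z.
Proof.
  intros H1 H2. destruct (lt_total x y) as [H|[->|H]]; auto; [|contradiction].
  eapply lt_trans; eauto.
Qed.

Lemma lt_le_trans x y z : lt x y -> ~ lt z y -> lt x z.
Proof.
  intros H1 H2. destruct (lt_total y z) as [H|[<-|H]]; auto; [|contradiction].
  eapply lt_trans; eauto.
Qed.

Lemma le_trans x y z : ~ lt y x -> ~ lt z y -> ~ lt z x.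
Proof. intros H1 H2 H. exact (H2 (lt_le_trans _ _ _ H H1)). Qed.

Lemma lt_not_lt x y : lt x y -> ~ lt y x.
Proof. intros H1 H2. exact (lt_irrefl _ (lt_trans _ _ _ H1 H2)). Qed.

Lemma exists_least (P : K -> Prop) :
  (exists x, P x) -> exists x, P x /\ forall y, P y -> ~ lt y x.
Proof.
  intros [x Hx]. induction x as [x IH] using (well_founded_induction wf).
  destruct (classic (exists y, P y /\ lt y x)) as [[y [Hy L]]|H].
  - exact (IH y L Hy).
  - exists x. split; auto. intros y Hy L. apply H. eauto.
Qed.

Lemma bounded_small (X : K -> Prop) b : (forall x, X x -> lt x b) -> small X.
Proof.
  intros H C. apply (proj2 Hcard b).
  eapply card_le_trans; [exact C|]. now apply card_le_incl.
Qed.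

Lemma uncountable_inhabited : inhabited K.
Proof.
  apply NNPP. intros E. apply Hunc. exists (fun _ => 0). split; [intros; exact I|].
  intros x. exfalso. apply E. now constructor.
Qed.

Lemma exists_gt a : exists b, lt a b.
Proof.
  destruct (Hreg (fun x => x = a)) as [b Hb].
  - intros [f [Hf If]]. apply Hunc. exists (fun _ => 0). split.
    + intros; exact I.
    + intros x y _ _ _. apply If; try exact I.
      now rewrite (Hf x I), (Hf y I).
  - exists b. now apply Hb.
Qed.

Lemma exists_gt2 a b : exists c, lt a c /\ lt b c.
Proof.
  destruct (exists_gt a) as [c Hc], (exists_gt b) as [d Hd].
  destruct (lt_total c d) as [H|[->|H]]; eauto using lt_trans.
Qed.

Lemma unbounded_big (X : K -> Prop) :
  (forall a, exists x, X x /\ ~ lt x a) -> big X.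
Proof.
  intros H. apply NNPP. intros S. destruct (Hreg X S) as [b Hb].
  destruct (H b) as [x [Hx L]]. auto.
Qed.

Lemma big_unbounded (X : K -> Prop) a : big X -> exists x, X x /\ ~ lt x a.
Proof.
  intros HX. apply NNPP. intros H. apply (bounded_small X a); auto.
  intros x Hx. apply NNPP. eauto.
Qed.

Lemma small_incl (X Y : K -> Prop) : (forall x, X x -> Y x) -> small Y -> small X.
Proof.
  intros H S C. apply S. eapply card_le_trans; [exact C|]. now apply card_le_incl.
Qed.

(** If the image were not small, choosing preimages would embed [K] into the segment below [a]; so
    it is small, and regularity bounds it. *)
Lemma segment_image_bounded (p : K -> K) a : exists m, forall j, lt j a -> lt (p j) m.
Proof.
  destruct (Hreg (fun y => exists j, lt j a /\ p j = y)) as [m Hm].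
  - intros C. apply (proj2 Hcard a).
    refine (card_le_of_image (fun j => lt j a) p _ _ C). auto.
  - exists m. intros j Hj. apply Hm. eauto.
Qed.

Lemma sequence_bounded (s : nat -> K) : exists m, forall n, lt (s n) m.
Proof.
  destruct (Hreg (fun y => exists n, s n = y)) as [m Hm].
  - intros C. apply Hunc.
    refine (card_le_of_image full s _ _ C). intros y [n Hn]. exists n. split; auto. exact I.
  - exists m. intros n. apply Hm. eauto.
Qed.

Lemma exists_majorant (p : K -> K) :
  exists q, forall j c, ~ lt c j -> lt (p j) (q c).
Proof.
  destruct (functional_choice (fun c m => forall j, ~ lt c j -> lt (p j) m)) as [q Hq].
  - intros c. destruct (exists_gt c) as [c' Hc].
    destruct (segment_image_bounded p c') as [m Hm]. exists m.
    intros j Hj. apply Hm. eapply le_lt_trans; eauto.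
  - exists q. auto.
Qed.

Lemma exists_lub (P : K -> Prop) a :
  (forall x, P x -> ~ lt a x) ->
  exists s, (forall x, P x -> ~ lt s x) /\ forall y, lt y s -> exists x, P x /\ lt y x.
Proof.
  intros H. destruct (exists_least (fun s => forall x, P x -> ~ lt s x)) as [s [Hs L]]; eauto.
  exists s. split; auto. intros y Hy. apply NNPP. intros N. apply (L y); auto.
  intros x Hx Lx. eauto.
Qed.

(** * Closed points *)

(* The first conjunct excludes the least element, which is closed under every [p]. *)
Definition closed_under (p : K -> K) (c : K) : Prop :=
  (exists j, lt j c) /\ forall j, lt j c -> lt (p j) c.

(** The supremum of the sequence [s] is closed: any [j] below it is below some [s n], so [p j] is
    below [q (s n)], hence below [s (S n)]. *)
Lemma exists_closed_above (p : K -> K) a : exists c, closed_under p c /\ lt a c.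
Proof.
  destruct (exists_majorant p) as [q Hq].
  destruct (functional_choice (fun x y => lt x y /\ lt (q x) y)) as [r Hr].
  { intros x. apply exists_gt2. }
  set (s := fun n => Nat.iter n r a).
  assert (Hs : forall n, lt (s n) (s (S n)) /\ lt (q (s n)) (s (S n))) by (intros; apply Hr).
  destruct (sequence_bounded s) as [m Hm].
  destruct (exists_lub (fun x => exists n, s n = x) m) as [c [Hc Lc]].
  { intros x [n <-]. apply lt_not_lt, Hm. }
  assert (Hsc : forall n, lt (s n) c).
  { intros n. apply lt_le_trans with (s (S n)); [apply Hs|apply Hc; eauto]. }
  exists c. split; [split|exact (Hsc 0)].
  - exists a. exact (Hsc 0).
  - intros j Hj. destruct (Lc j Hj) as [x [[n <-] L]].
    apply lt_trans with (s (S n)); auto.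
    apply lt_trans with (q (s n)); [|apply Hs]. apply Hq. now apply lt_not_lt.
Qed.

(** A supremum of closed points is closed, so the supremum of those up to [a] is the last one. *)
Lemma exists_last_closed (p : K -> K) a :
  (exists c, closed_under p c /\ ~ lt a c) ->
  exists c, closed_under p c /\ ~ lt a c /\
    forall d, closed_under p d -> ~ lt a d -> ~ lt c d.
Proof.
  intros [c0 [H0 L0]].
  destruct (exists_lub (fun c => closed_under p c /\ ~ lt a c) a) as [s [Hs Ls]].
  { now intros x [_ H]. }
  exists s. repeat split.
  - destruct H0 as [[j Hj] C]. exists j. apply lt_le_trans with c0; auto. apply Hs.
    split; auto. split; eauto.
  - intros j Hj. destruct (Ls j Hj) as [x [[Hx Lx] L]].
    apply lt_le_trans with x; [now apply Hx|]. now apply Hs.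
  - intros L. destruct (Ls a L) as [x [[_ Hx] L']]. contradiction.
  - intros d Hd Ld. now apply Hs.
Qed.

(* Cummings and Shelah.  If every family were bounded modulo clubs, let [C_0] be a club on
   which [g_0] bounds [f], and let [C_(n+1)] be a subclub of [C_n] on which [g_(n+1)] bounds
   the successor function of [C_n].  The last points of [C_n] up to [x] decrease with [n],
   hence two consecutive ones agree; their common value [c] satisfies
   [f x <= g_0 (g_(n+1) c)], so [f] is bounded by a function that does not depend on [f]. *)
Lemma unbounded_mod_club (F : (K -> K) -> Prop) :
  unbounded lt F ->
  exists phi : (K -> K) -> K -> K, forall g, exists f, F f /\
    forall p, exists c, closed_under p c /\ lt (g c) (phi f c).
Proof.
  intros HF. apply NNPP. intros N.
  (* One [g] serves all [f]; only the club depends on [f]. This uniformity makes the final bound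
     independent of [f]. *)
  assert (H : forall phi : (K -> K) -> K -> K,
    exists gp : (K -> K) * ((K -> K) -> K -> K), forall f, F f ->
    forall c, closed_under (snd gp f) c -> ~ lt (fst gp c) (phi f c)).
  { intros phi. apply NNPP. intros H. apply N. exists phi. intros g.
    apply NNPP. intros Hg. apply H.
    destruct (functional_choice (fun (f : K -> K) (p : K -> K) => F f ->
      forall c, closed_under p c -> ~ lt (g c) (phi f c))) as [p Hp].
    - intros f. destruct (classic (F f)) as [Ff|Ff]; [|exists f; tauto].
      apply NNPP. intros Hf. apply Hg. exists f. split; auto. intros p.
      apply NNPP. intros Hp. apply Hf. exists p. intros _ c Hc L. apply Hp. eauto.
    - exists (g, p). exact Hp. }
  clear N.
  destruct (functional_choice _ H) as [sel Hsel].
  destruct (functional_choice _ exists_majorant) as [maj Hmaj].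
  destruct (functional_choice (fun (pa : (K -> K) * K) c =>
    closed_under (fst pa) c /\ lt (snd pa) c)) as [next Hnext].
  { intros [p a]. apply exists_closed_above. }
  destruct (functional_choice (fun (ab : K * K) c => lt (fst ab) c /\ lt (snd ab) c))
    as [join Hjoin].
  { intros [a b]. apply exists_gt2. }
  set (succ := fun (P : (K -> K) -> K -> K) f c => next (P f, c)).
  (* The closed points of [P n f] form the club C_n of [f]; [join] dominates the previous function,
     so the clubs shrink. The recursion starts from [maj] so that a bound at [d] controls [f x] for
     all [x] up to [d]. *)
  set (P := fix P n := match n with
    | 0 => snd (sel maj)
    | S n => fun f j => join (P n f j, snd (sel (succ (P n))) f j) end).
  set (g0 := fst (sel maj)).
  set (g := fun n => fst (sel (succ (P n)))).
  assert (Pdec : forall n f c, closed_under (P (S n) f) c -> closed_under (P n f) c).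
  { intros n f c [Hj Hc]. split; auto. intros j L. eapply lt_trans; [|exact (Hc j L)].
    exact (proj1 (Hjoin (P n f j, snd (sel (succ (P n))) f j))). }
  assert (P0 : forall n f c, closed_under (P n f) c -> closed_under (P 0 f) c).
  { induction n; auto. }
  assert (Hg0 : forall f c, F f -> closed_under (P 0 f) c -> ~ lt (g0 c) (maj f c)).
  { intros f c Ff. apply Hsel. exact Ff. }
  assert (Hg : forall n f c, F f -> closed_under (P (S n) f) c ->
    ~ lt (g n c) (next (P n f, c))).
  { intros n f c Ff [Hj Hc]. refine (Hsel (succ (P n)) f Ff c _). split; auto.
    intros j L. eapply lt_trans; [|exact (Hc j L)].
    exact (proj2 (Hjoin (P n f j, snd (sel (succ (P n))) f j))). }
  (* The inner [maj g0] covers all arguments up to [g n c], the outer [maj] all [c] up to [x]. *)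
  set (G := fun n => maj (fun c => maj g0 (g n c))).
  destruct (functional_choice (fun x m => forall n, lt (G n x) m)) as [h Hh].
  { intros x. apply sequence_bounded. }
  apply HF. exists h. intros f Ff.
  (* From a common bound [m] of one point of each club on, every club has a last point up to [x]. *)
  destruct (functional_choice (fun n c => closed_under (P n f) c)) as [s Hs].
  { intros n.
    destruct uncountable_inhabited as [a].
    destruct (exists_closed_above (P n f) a) as [c [Hc _]]. eauto. }
  destruct (sequence_bounded s) as [m Hm].
  apply (bounded_small _ m). intros x Hx.
  destruct (lt_total x m) as [L|L]; auto. exfalso.
  assert (Lm : ~ lt x m).
  { destruct L as [->|L]; [apply lt_irrefl|now apply lt_not_lt]. }
  destruct (functional_choice (fun n c => closed_under (P n f) c /\ ~ lt x c /\
    forall d, closed_under (P n f) d -> ~ lt x d -> ~ lt c d)) as [last Hlast].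
  { intros n. apply exists_last_closed. exists (s n). split; auto.
    apply lt_not_lt. eapply lt_le_trans; eauto. }
  destruct (exists_least (fun c => exists n, last n = c)) as [c [[n Hn] Lc]].
  { exists (last 0). eauto. }
  assert (E : last (S n) = c).
  { destruct (lt_total (last (S n)) c) as [L1|[L1|L1]]; auto; exfalso.
    - exact (Lc (last (S n)) (ex_intro _ _ eq_refl) L1).
    - destruct (Hlast (S n)) as [C1 [C2 _]]. rewrite <- Hn in L1.
      exact (proj2 (proj2 (Hlast n)) _ (Pdec _ _ _ C1) C2 L1). }
  destruct (Hlast (S n)) as [C1 [C2 _]]. rewrite E in C1, C2.
  pose proof (Hg n f c Ff C1) as B1.
  destruct (Hnext (P n f, c)) as [D1 D2]. cbn [fst snd] in D1, D2.
  (* As [c] is the last point of the club up to [x], its successor [d] lies beyond [x], while [B1]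
     puts [d] at most at [g n c]. *)
  set (d := next (P n f, c)) in *.
  assert (D3 : lt x d).
  { apply NNPP. intros D3. apply (proj2 (proj2 (Hlast n)) d D1 D3). now rewrite Hn. }
  pose proof (Hg0 f d Ff (P0 _ _ _ D1)) as B2.
  assert (Q1 : lt (f x) (g0 d)).
  { apply lt_le_trans with (maj f d); auto. apply Hmaj. now apply lt_not_lt. }
  assert (Q2 : lt (g0 d) (maj g0 (g n c))) by (now apply Hmaj).
  assert (Q3 : lt (maj g0 (g n c)) (G n x)).
  { exact (Hmaj (fun c => maj g0 (g n c)) c x C2). }
  apply (lt_irrefl (f x)). eapply lt_trans; [exact Q1|]. eapply lt_trans; [exact Q2|].
  eapply lt_trans; [exact Q3|]. eapply lt_trans; [exact (Hh x n)|exact Hx].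
Qed.

(** * Almost disjoint families *)

(** Row [b] consists of the points [q (M b) j] with [j] below [b]; [M b] is chosen above all earlier
    rows, so rows are disjoint. [D j] collects the [j]-th point of every row beyond [j]. *)
Lemma exists_disjoint_big_sets :
  exists D : K -> K -> Prop, (forall j, big (D j)) /\
    forall i j x, D i x -> D j x -> i = j.
Proof.
  assert (Hq : forall m, exists q : K -> K, (forall x, ~ lt (q x) m) /\
    forall x y, q x = q y -> x = y).
  { intros m. destruct (unbounded_big (fun x => ~ lt x m)) as [q [H1 H2]].
    - intros a. destruct (exists_gt2 a m) as [x [L1 L2]]. exists x.
      split; now apply lt_not_lt.
    - exists q. split; intros; [apply H1|apply H2]; auto; exact I. }
  destruct (functional_choice _ Hq) as [q H].
  assert (HM : forall (M : K -> K) b, exists m,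
    ~ lt m b /\ forall c j, lt c b -> lt j c -> lt (q (M c) j) m).
  { intros M b.
    destruct (functional_choice _ (fun c => segment_image_bounded (q (M c)) c)) as [u Hu].
    destruct (segment_image_bounded u b) as [v Hv].
    destruct (exists_gt2 v b) as [m [L1 L2]]. exists m. split; [now apply lt_not_lt|].
    intros c j Lc Lj. eauto using lt_trans. }
  destruct (functional_choice (fun (Mb : (K -> K) * K) m => ~ lt m (snd Mb) /\
    forall c j, lt c (snd Mb) -> lt j c -> lt (q (fst Mb c) j) m)) as [next Hnext].
  { intros [M b]. apply HM. }
  destruct (well_founded_fixpoint lt wf (fun b (M : forall c, lt c b -> K) =>
    (* The default [b] is harmless: [next] gives bounds only for [c] below [b]. *)
    next (fun c => match excluded_middle_informative (lt c b) with
                   | left L => M c L | right _ => b end, b))) as [M HMf].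
  assert (M1 : forall b, ~ lt (M b) b).
  { intros b. rewrite HMf. exact (proj1 (Hnext (_, b))). }
  assert (M2 : forall b c j, lt c b -> lt j c -> lt (q (M c) j) (M b)).
  { intros b c j Lc Lj. rewrite (HMf b).
    pose proof (proj2 (Hnext (fun c => if excluded_middle_informative (lt c b)
      then M c else b, b)) c j Lc Lj) as X. cbn [fst] in X.
    destruct (excluded_middle_informative (lt c b)); [exact X|contradiction]. }
  exists (fun j x => exists b, lt j b /\ q (M b) j = x). split.
  - intros j. apply unbounded_big. intros a. destruct (exists_gt2 a j) as [b [La Lj]].
    exists (q (M b) j). split; eauto. intros L.
    apply (M1 b). apply lt_trans with a; auto.
    eapply le_lt_trans; [apply H|exact L].
  - intros i j x [b [Lb Eb]] [c [Lc Ec]]. subst x.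
    destruct (lt_total b c) as [L|[->|L]].
    + exfalso. apply (proj1 (H (M c)) j). rewrite Ec. auto.
    + symmetry. now apply (proj2 (H (M c))).
    + exfalso. apply (proj1 (H (M b)) i). rewrite <- Ec. auto.
Qed.

Lemma exists_mad_family {J : Type} (F : J -> Prop) (R : J -> J -> Prop)
  (phi : J -> K -> K) :
  well_order_on F R ->
  (forall f, F f -> card_le (fun y => F y /\ R y f) (@full K)) ->
  (forall g, exists f, F f /\
    forall p, exists c, closed_under p c /\ lt (g c) (phi f c)) ->
  exists (D : K -> K -> Prop) (A : J -> K -> Prop),
    mad (fun X => (exists j, D j = X) \/ exists f, (F f /\ big (A f)) /\ A f = X).
Proof.
  intros [wfR [_ [_ Rtot]]] Rseg Hphi.
  destruct exists_disjoint_big_sets as [D [Dbig Ddis]].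
  destruct (functional_choice (fun (f : J) (e : J -> K) => F f ->
    forall y z, F y -> R y f -> F z -> R z f -> e y = e z -> y = z)) as [e He].
  { intros f. destruct (classic (F f)) as [Ff|Ff].
    - destruct (Rseg f Ff) as [e [_ He]]. exists e. auto.
    - destruct uncountable_inhabited as [a]. exists (fun _ => a). tauto. }
  destruct (well_founded_fixpoint R wfR (fun f (A : forall y, R y f -> K -> Prop) x =>
    exists c, ~ lt x c /\ lt x (phi f c) /\ (forall j, lt j c -> ~ D j x) /\
      forall y (r : R y f), F y -> lt (e f y) c -> ~ A y r x)) as [A HA].
  assert (DA : forall j f, small (fun x => D j x /\ A f x)).
  (* A point of [D j] enters [A f] only through an interval with [c] at most [j], and these all end
     below [q j]. *)
  { intros j f. destruct (exists_majorant (phi f)) as [q Hq].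
    apply (bounded_small _ (q j)). intros x [Dx Ax]. rewrite HA in Ax.
    destruct Ax as [c [_ [L [N _]]]].
    apply lt_trans with (phi f c); auto. apply Hq. intros Lj. exact (N j Lj Dx). }
  assert (AA : forall y f, F y -> R y f -> small (fun x => A y x /\ A f x)).
  { intros y f Fy r. destruct (exists_majorant (phi f)) as [q Hq].
    apply (bounded_small _ (q (e f y))). intros x [Ay Ax]. rewrite HA in Ax.
    destruct Ax as [c [_ [L [_ N]]]].
    apply lt_trans with (phi f c); auto. apply Hq. intros Lj. exact (N y r Fy Lj Ay). }
  assert (sym : forall X Y : K -> Prop, small (fun x => X x /\ Y x) ->
    small (fun x => Y x /\ X x)).
  { intros X Y. apply small_incl. tauto. }
  exists D, A. split; [|split; [|split]].
  - intros X [[j <-]|[f [[_ H] <-]]]; auto.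
  - intros X Y [[i <-]|[f [[Ff _] <-]]] [[j <-]|[g [[Fg _] <-]]] N; unfold almost_disjoint;
      auto.
    + destruct uncountable_inhabited as [a]. apply (bounded_small _ a).
      intros x [H1 H2]. destruct N. now rewrite (Ddis i j x H1 H2).
    + destruct (Rtot f g Ff Fg) as [r|[->|r]]; auto. now destruct N.
  - exists D. split; [eauto|]. intros i j _ _ E.
    destruct uncountable_inhabited as [a].
    destruct (big_unbounded (D i) a (Dbig i)) as [x [Hx _]].
    apply (Ddis i j x Hx). now rewrite <- E.
  - intros [B [Bbig Bad]].
    destruct (functional_choice (fun c x => B x /\ ~ lt x c)) as [g Hg].
    { intros c. now apply big_unbounded. }
    destruct (Hphi g) as [f [Ff Hf]].
    assert (AB : forall y, F y -> small (fun x => A y x /\ B x)).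
    (* A small [A y] is left out of the family, but its intersection with [B] is small anyway. *)
    { intros y Fy. destruct (classic (big (A y))) as [H|H].
      - apply Bad. eauto.
      - revert H. apply small_incl. tauto. }
    (* Since [e f] is injective on the predecessors of [f], each [j] concerns [D j] and at most one
       [A y]. *)
    assert (Hp : forall j, exists m, (forall x, D j x /\ B x -> lt x m) /\
      forall y, F y -> R y f -> e f y = j -> forall x, A y x /\ B x -> lt x m).
    { intros j. destruct (Hreg (fun x => D j x /\ B x)) as [u Hu]; [apply Bad; eauto|].
      destruct (classic (exists y, F y /\ R y f /\ e f y = j)) as [[y [Fy [r Ey]]]|N].
      - destruct (Hreg _ (AB y Fy)) as [v Hv]. destruct (exists_gt2 u v) as [m [L1 L2]].
        exists m. split; [eauto using lt_trans|].
        intros z Fz rz Ez. rewrite <- Ey in Ez.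
        rewrite (He f Ff z y Fz rz Fy r Ez). eauto using lt_trans.
      - exists u. split; auto. intros y Fy r Ey. destruct N. eauto. }
    destruct (functional_choice _ Hp) as [p Hpp].
    destruct (Hreg _ (AB f Ff)) as [a Ha].
    (* A point [c] closed under [q] exceeds [p j] for all [j] below it, and also [a], because some
       [j] is below [c]. Then [g c] is in both [A f] and [B] but not below [a]. *)
    destruct (functional_choice (fun j m => lt (p j) m /\ lt a m)) as [q Hq].
    { intros j. apply exists_gt2. }
    destruct (Hf q) as [c [[[j Lj] Hc] L]]. destruct (Hg c) as [Bx Lx].
    assert (Hpc : forall j, lt j c -> lt (p j) (g c)).
    { intros i Li. apply lt_le_trans with c; auto.
      eapply lt_trans; [apply Hq|]. auto. }
    apply (lt_irrefl a). apply lt_trans with c.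
    { eapply lt_trans; [apply (Hq j)|]. auto. }
    eapply le_lt_trans; [exact Lx|]. apply Ha. split; auto.
    rewrite HA. exists c. repeat split; auto.
    + intros i Li Di. apply (lt_not_lt _ _ (Hpc i Li)). now apply Hpp.
    + intros y r Fy Ly Ay. apply (lt_not_lt _ _ (Hpc _ Ly)).
      apply (proj2 (Hpp (e f y)) y Fy r eq_refl). auto.
Qed.

(** Each set gets one code in [K + J], and the ordered sum with [K] first is pulled back along the
    codes. Initial segments have size at most kappa + kappa = kappa. *)
Lemma well_order_of_codes {J T : Type} (F : J -> Prop) (R : J -> J -> Prop)
  (D : K -> T) (A : J -> T) (S : T -> Prop) :
  well_order_on F R ->
  (forall f, F f -> card_le (fun y => F y /\ R y f) (@full K)) ->
  (forall X, S X -> (exists j, D j = X) \/ exists f, F f /\ A f = X) ->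
  exists Q, well_order_on S Q /\
    forall X, S X -> card_le (fun Y => S Y /\ Q Y X) (@full K).
Proof.
  intros [wfR [Rirr [Rtrans Rtot]]] Rseg HS.
  destruct uncountable_inhabited as [k0].
  destruct (functional_choice (fun X (c : K + J) => S X ->
    match c with inl j => D j = X | inr f => F f /\ A f = X end)) as [code Hcode].
  { intros X. destruct (classic (S X)) as [H|H]; [|exists (inl k0); tauto].
    destruct (HS X H) as [[j Hj]|[f Hf]]; [exists (inl j)|exists (inr f)]; auto. }
  assert (inj : forall X Y, S X -> S Y -> code X = code Y -> X = Y).
  { intros X Y HX HY E. apply Hcode in HX, HY. rewrite E in HX.
    destruct (code Y) as [j|f]; [congruence|].
    destruct HX as [_ <-], HY as [_ <-]. reflexivity. }
  set (W := le_AsB K J lt R).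
  exists (fun X Y => W (code X) (code Y)). split; [split; [|split; [|split]]|].
  - apply wf_inverse_image. now apply wf_disjoint_sum.
  - intros X HX H. pose proof (Hcode X HX) as C. destruct (code X) as [j|f].
    + inversion H; subst. eapply lt_irrefl; eauto.
    + inversion H; subst. eapply Rirr; [|eauto]. tauto.
  - intros X Y Z HX HY HZ H1 H2.
    pose proof (Hcode X HX) as CX. pose proof (Hcode Y HY) as CY.
    pose proof (Hcode Z HZ) as CZ.
    destruct (code X) as [x|x], (code Y) as [y|y], (code Z) as [z|z];
      inversion H1; inversion H2; subst; constructor.
    + eapply lt_trans; eauto.
    + apply Rtrans with y; tauto.
  - intros X Y HX HY.
    pose proof (Hcode X HX) as CX. pose proof (Hcode Y HY) as CY.
    destruct (code X) as [i|f] eqn:EX, (code Y) as [j|g] eqn:EY.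
    + destruct (lt_total i j) as [L|[->|L]].
      * left. now constructor.
      * right; left. apply inj; auto; congruence.
      * right; right. now constructor.
    + left. constructor.
    + right; right. constructor.
    + destruct (Rtot f g) as [L|[->|L]]; try tauto.
      * left. now constructor.
      * right; left. apply inj; auto; congruence.
      * right; right. now constructor.
  - intros X HX.
    assert (seg : exists e : J -> K, forall f y z, code X = inr f -> F y -> R y f ->
      F z -> R z f -> e y = e z -> y = z).
    { pose proof (Hcode X HX) as CX. destruct (code X) as [j|f].
      - exists (fun _ => k0). discriminate.
      - destruct (Rseg f) as [e [_ He]]; [tauto|]. exists e.
        intros f' y z [= <-]. auto. }
    destruct seg as [e He].
    (* Two disjoint big sets host the two summands, which gives the injection of [K + K] into
       [K]. *)
    destruct exists_disjoint_big_sets as [E [Ebig Edis]].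
    destruct (exists_gt k0) as [k1 L01].
    destruct (Ebig k0) as [u [Hu Iu]], (Ebig k1) as [v [Hv Iv]].
    assert (uv : forall a b, u a <> v b).
    { intros a b Eq. apply (lt_irrefl k0). rewrite (Edis k0 k1 (u a)) at 2; auto.
      - apply Hu. exact I.
      - rewrite Eq. apply Hv. exact I. }
    exists (fun Y => match code Y with inl j => u j | inr f => v (e f) end).
    split; [intros; exact I|].
    intros Y Z [SY QY] [SZ QZ] Eq.
    pose proof (Hcode Y SY) as CY. pose proof (Hcode Z SZ) as CZ.
    apply inj; auto.
    destruct (code Y) as [i|y], (code Z) as [j|z].
    + f_equal. apply Iu; auto; exact I.
    + now apply uv in Eq.
    + symmetry in Eq. now apply uv in Eq.
    + apply Iv in Eq; try exact I.
      destruct (code X) as [j|f] eqn:EX; inversion QY; inversion QZ; subst.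
      f_equal. apply (He f); tauto.
Qed.

(** Diagonalization: if [h] indexes the family by [P], pick [b i] in [X i], not below [i] and
    outside every earlier [X j]. By regularity the earlier intersections are bounded together. The
    points [b i] form a big set meeting [X j] only in points [b i] with [i] at most [j]. *)
Lemma mad_not_card_le (A : (K -> Prop) -> Prop) : mad A -> ~ card_le A (@full K).
Proof.
  intros [Abig [Aad [AK Amax]]] [h [_ Ih]].
  set (P := fun i => exists X, A X /\ h X = i).
  destruct (functional_choice (fun i X => P i -> A X /\ h X = i)) as [X HX].
  { intros i. destruct (classic (P i)) as [[X H]|H]; [exists X; auto|].
    exists (fun _ => True). tauto. }
  assert (Pbig : big P).
  { destruct AK as [k [Hk Ik]]. exists (fun i => h (k i)). split.
    - intros i _. exists (k i). split; auto. apply Hk. exact I.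
    - intros i j _ _ E. apply Ik; try exact I. apply Ih; auto; apply Hk; exact I. }
  destruct (functional_choice (fun i b => P i -> X i b /\ ~ lt b i /\
    forall j, P j -> lt j i -> ~ X j b)) as [b Hb].
  { intros i. destruct (classic (P i)) as [Pi|Pi]; [|exists i; tauto].
    destruct (functional_choice (fun j m => P j -> lt j i ->
      forall x, X i x /\ X j x -> lt x m)) as [m Hm].
    { intros j. destruct (classic (P j /\ lt j i)) as [[Pj L]|N]; [|exists i; tauto].
      destruct (Hreg (fun x => X i x /\ X j x)) as [m Hm]; eauto.
      apply Aad; try (now apply HX). intros E. apply (lt_irrefl i).
      rewrite <- (proj2 (HX i Pi)) at 1. rewrite E, (proj2 (HX j Pj)). exact L. }
    destruct (segment_image_bounded m i) as [u Hu].
    destruct (exists_gt2 u i) as [v [Lu Li]].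
    destruct (big_unbounded (X i) v) as [x [Hx Lx]].
    { apply Abig. now apply HX. }
    exists x. intros _. repeat split; auto.
    - intros L. apply Lx. eauto using lt_trans.
    - intros j Pj L Xj. apply Lx. eapply lt_trans; [apply (Hm j); auto|].
      eauto using lt_trans. }
  apply Amax. exists (fun x => exists i, P i /\ b i = x). split.
  - apply unbounded_big. intros a. destruct (big_unbounded P a Pbig) as [i [Pi Li]].
    exists (b i). split; eauto. eapply le_trans; [exact Li|]. now apply Hb.
  - intros Y HY. assert (PY : P (h Y)) by (exists Y; auto).
    assert (EY : X (h Y) = Y).
    { destruct (HX _ PY) as [H1 H2]. now apply Ih. }
    destruct (exists_gt (h Y)) as [c Hc].
    destruct (segment_image_bounded b c) as [m Hm].
    apply (bounded_small _ m). intros x [Yx [i [Pi <-]]]. apply Hm.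
    apply NNPP. intros L. apply (proj2 (proj2 (Hb i Pi)) (h Y) PY).
    + eapply lt_le_trans; eauto.
    + now rewrite EY.
Qed.

End RegularCardinal.

Theorem theorem2p2 (K : Type) (lt : K -> K -> Prop) :
  is_cardinal lt -> is_regular lt -> uncountable (K := K) ->
  b_eq_succ lt -> a_eq_succ (K := K).
Proof.
  intros Hc Hr Hu [[F [HF [_ [R [HR Rseg]]]]] _]. split.
  - destruct (unbounded_mod_club lt Hc Hr Hu F HF) as [phi Hphi].
    destruct (exists_mad_family lt Hc Hr Hu F R phi HR Rseg Hphi) as [D [A M]].
    exists (fun X => (exists j, D j = X) \/ exists f, (F f /\ big (A f)) /\ A f = X).
    split; [exact M|split].
    (* Maximality forces size above kappa; the well-order of codes then gives exactly kappa^+. *)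
    + exact (mad_not_card_le lt Hc Hr Hu _ M).
    + apply (well_order_of_codes lt Hc Hr Hu F R D A); auto.
      intros X [H|[f [[Ff _] E]]]; eauto.
  - intros A HA. exact (mad_not_card_le lt Hc Hr Hu A HA).
Qed.
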